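(* If $M$ is a matroid of rank $4$ that is OTE, then $M$ is sticky.
   Context: A modular cut of a matroid $M$ is a set $\mathcal{M}$ of flats of $M$ such that (1) if $F\in\mathcal{M}$ and $F'\supseteq F$ is a flat, then $F'\in\mathcal{M}$; (2) if $F_1,F_2\in\mathcal{M}$ and $(F_1,F_2)$ is a modular pair, i.e. $\operatorname{rk}(F_1)+\operatorname{rk}(F_2)=\operatorname{rk}(F_1\cup F_2)+\operatorname{rk}(F_1\cap F_2)$, then $F_1\cap F_2\in\mathcal{M}$. For a flat $F$, the principal modular cut is $\mathcal{M}_F=\{G: G \text{ a flat of } M, G\supseteq F\}$. A matroid is OTE (only trivially extendable) if every modular cut other than the empty modular cut is principal. An extension of a matroid $M$ on $E$ is a matroid $N$ on $F\supseteq E$ with $N|E=M$. If $N_1,N_2$ are extensions of $M$ on ground sets $F_1,F_2$ with $F_1\cap F_2=E$, an amalgam of $N_1,N_2$ is a matroid on $F_1\cup F_2$ whose restriction to $F_i$ is $N_i$ ($i=1,2$). $M$ is sticky if an amalgam exists for every such pair of extensions. *)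

(* Defs.v *)
From mathcomp Require Import all_boot.
From mathcomp Require Import boolp classical_sets functions cardinality.

Set Implicit Arguments.
Unset Strict Implicit.
Unset Printing Implicit Defensive.

Local Open Scope classical_set_scope.
Local Open Scope card_scope.

(* Matroids of finite rank, given by their rank function.  The ground set may
   be infinite.  The axiom [rk_finitary] makes [rk] the rank function of a
   family of independent sets in that case; it holds trivially (take I = X)
   when the ground set is finite.
   The values of [rk] outside the subsets of the ground set are junk. *)
Record matroid (T : Type) := Matroid {
  ground : set T;
  rk : set T -> nat;
  rk_card : forall (X : set T) (n : nat),
    X `<=` ground -> X #= `I_n -> (rk X <= n)%N;
  rk_mono : forall X Y : set T,
    X `<=` Y -> Y `<=` ground -> (rk X <= rk Y)%N;
  rk_submod : forall X Y : set T, X `<=` ground -> Y `<=` ground ->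
    (rk (X `|` Y) + rk (X `&` Y) <= rk X + rk Y)%N;
  rk_finitary : forall X : set T, X `<=` ground ->
    exists I : set T, [/\ I `<=` X, finite_set I & rk I = rk X] }.

Definition rank T (M : matroid T) : nat := rk M (ground M).

Definition flat T (M : matroid T) (F : set T) : Prop :=
  F `<=` ground M /\
  forall x, ground M x -> rk M (x |` F) = rk M F -> F x.

Definition modular_pair T (M : matroid T) (F1 F2 : set T) : Prop :=
  (rk M F1 + rk M F2 = rk M (F1 `|` F2) + rk M (F1 `&` F2))%N.

Definition modular_cut T (M : matroid T) (C : set (set T)) : Prop :=
  [/\ C `<=` flat M,
      forall F F', C F -> flat M F' -> F `<=` F' -> C F'
    & forall F1 F2, C F1 -> C F2 -> modular_pair M F1 F2 -> C (F1 `&` F2)].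

Definition principal_cut T (M : matroid T) (F : set T) : set (set T) :=
  [set G | flat M G /\ F `<=` G].

Definition OTE T (M : matroid T) : Prop :=
  forall C : set (set T), modular_cut M C -> C <> set0 ->
    exists F : set T, flat M F /\ C = principal_cut M F.

(* [N] restricted to the ground set of [M] is [M]. *)
Definition extension T (M N : matroid T) : Prop :=
  ground M `<=` ground N /\
  forall X : set T, X `<=` ground M -> rk N X = rk M X.

Definition amalgam T (N1 N2 N : matroid T) : Prop :=
  [/\ ground N = ground N1 `|` ground N2, extension N1 N & extension N2 N].

Definition isomorphic T U (M : matroid T) (M' : matroid U) : Prop :=
  exists f : T -> U,
    [/\ set_inj (ground M) f,
        ground M' = f @` ground M
      & forall X : set T, X `<=` ground M -> rk M' (f @` X) = rk M X].

Definition sticky_within U (M : matroid U) : Prop :=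
  forall N1 N2 : matroid U,
    extension M N1 -> extension M N2 ->
    ground N1 `&` ground N2 = ground M ->
    exists N : matroid U, amalgam N1 N2 N.

(* The ambient type [T] of [M] need not have room for all the extensions of
   [M] (it may even be exhausted by the ground set), so stickiness quantifies
   over the copies of [M] in arbitrary ambient types. *)
Definition sticky T (M : matroid T) : Prop :=
  forall (U : Type) (M' : matroid U), isomorphic M M' -> sticky_within M'.

(* Main.v *)
(* The amalgam is the proper amalgam of N1 and N2: with Ei the ground sets and
   eta X = rk N1 (X & E1) + rk N2 (X & E2) - rk M (X & E), the rank of A is the
   minimum zeta A of eta over the supersets of A.  The issue is submodularity
   of zeta, and minimizers X, Y can be taken with flat traces on E1 and E2.
   The deficit eta X + eta Y - eta (X & Y) - eta (X | Y) is d1 + d2 - d0, the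
   modular defects of the pair (X, Y) in N1, N2 and M.  In an OTE matroid of
   rank 4 two planes are modular, so if d0 > d1 + d2 then d1 = d2 = 0, d0 = 1,
   and the traces F, G of X, Y on E meet in rank 0 and are two coplanar lines,
   or a line and a plane.  Contracting Z = X & Y in Ni gives a quotient Q of M.
   A quotient of rank 3 would give a modular cut containing F and G but not the
   flat of rank 0, and rank 4 contradicts di = 0; so Q has rank 2, and F and G
   have rank 1 in it.  Then eta drops by one either when the plane among F, G
   is added to X & Y, or, for two lines, when E is added to X | Y, and this
   makes up for the deficit. *)
Require Import Defs.
From mathcomp Require Import all_boot.
From mathcomp Require Import boolp classical_sets functions cardinality.
From mathcomp Require Import zify.

Set Implicit Arguments.
Unset Strict Implicit.
Unset Printing Implicit Defensive.

Local Open Scope classical_set_scope.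
Local Open Scope card_scope.

Local Ltac sets :=
  let x := fresh "x" in move=> x;
  repeat match goal with H : _ `<=` _ |- _ => move: (H x); clear H end;
  rewrite /setU /setI /setD /set1 /mkset /=; tauto.
Local Ltac seteq := apply/seteqP; split; sets.

(** * Rank, closure and flats *)

Lemma rk_submod_le T (M : matroid T) (A B C D : set T) :
  A `<=` ground M -> B `<=` ground M -> C `<=` A `|` B -> D `<=` A `&` B ->
  rk M C + rk M D <= rk M A + rk M B.
Proof.
move=> sA sB sC sD; have := rk_submod sA sB.
have sU : A `|` B `<=` ground M by sets.
have sI : A `&` B `<=` ground M by sets.
have := rk_mono sC sU; have := rk_mono sD sI; lia.
Qed.

Lemma rk_set0 T (M : matroid T) : rk M set0 = 0.
Proof.
apply/eqP; rewrite -leqn0; apply: rk_card => //; by rewrite II0 card_eq0.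
Qed.

(** Submodularity for [B] and the union of [A] with [S]: these two meet in a superset of [A]. *)
Lemma rk_adjoin_eq T (M : matroid T) (A B S : set T) :
  B `<=` ground M -> S `<=` ground M -> A `<=` B ->
  rk M (A `|` S) = rk M A -> rk M (B `|` S) = rk M B.
Proof.
move=> sB sS sAB e.
have s : B `|` S `<=` ground M by sets.
have mB : B `<=` B `|` S by sets.
have := rk_mono mB s.
have := @rk_submod_le _ M B (A `|` S) (B `|` S) A.
move=> H; have := H ltac:(sets) ltac:(sets) ltac:(sets) ltac:(sets).
lia.
Qed.

Lemma flat_absorb T (M : matroid T) (F S : set T) :
  flat M F -> S `<=` ground M -> rk M (F `|` S) = rk M F -> S `<=` F.
Proof.
move=> [sF flF] sS e x Sx; apply: flF; first exact: sS.
have s1 : x |` F `<=` F `|` S by move=> y [->|]; [right|left].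
have s2 : F `<=` x |` F by sets.
have s3 : F `|` S `<=` ground M by sets.
have := rk_mono s1 s3.
have := rk_mono s2 (subset_trans s1 s3); lia.
Qed.

Definition cl T (M : matroid T) (A : set T) : set T :=
  [set x | ground M x /\ rk M (x |` A) = rk M A].

Lemma sub_cl T (M : matroid T) (A : set T) : A `<=` ground M -> A `<=` cl M A.
Proof.
move=> sA x Ax; split; first exact: sA.
by congr (rk M _); apply/seteqP; split=> [z [->|]|z] //; right.
Qed.

(** The closure may be infinite. [rk_finitary] supplies a finite set carrying the whole rank, and
    its elements are adjoined to [A] one at a time. *)
Lemma rk_cl T (M : matroid T) (A : set T) :
  A `<=` ground M -> rk M (A `|` cl M A) = rk M A.
Proof.
move=> sA.
have sU : A `|` cl M A `<=` ground M by move=> x [/sA|[]].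
have [I [sI /finite_setP[n cI] eI]] := rk_finitary sU.
have main k J : J #= `I_k -> J `<=` A `|` cl M A -> rk M (A `|` J) = rk M A.
  elim: k J => [|k IH] J.
    by rewrite II0 card_eq0 => /eqP -> _; rewrite setU0.
  move=> /eq_cardSP[x Jx cJ] sJ.
  have sJ' : J `\ x `<=` A `|` cl M A by move=> y [/sJ].
  have cx : rk M (A `|` [set x]) = rk M A.
    have [Ax|[_ e]] := sJ x Jx; last by rewrite setUC.
      by congr (rk M _); apply/seteqP; split=> [z [|->]|z] //; left.
  rewrite -(IH _ cJ sJ').
  have -> : A `|` J = (A `|` J `\ x) `|` [set x].
    apply/seteqP; split => y.
      by case=> [Ay|Jy]; [left; left|have [->|nyx] := EM (y = x); [right|left; right]].
    by case=> [[Ay|[Jy _]]|->]; [left|right|right].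
  apply: (@rk_adjoin_eq _ M A) => //.
  - by move=> y [/sA|/sJ'/sU].
  - by move=> _ ->; exact/sU/sJ.
have m := main n I cI sI.
have s1 : I `<=` A `|` I by move=> y; right.
have s2 : A `|` I `<=` ground M by move=> y [/sA|/sI/sU].
have s3 : A `<=` A `|` cl M A by move=> y; left.
have := rk_mono s1 s2; have := rk_mono s3 sU; lia.
Qed.

Lemma flat_cl T (M : matroid T) (A : set T) :
  A `<=` ground M -> flat M (cl M A).
Proof.
move=> sA; split=> [x []//|x gx e]; split=> //.
have sC : cl M A `<=` ground M by move=> y [].
have eC : cl M A = A `|` cl M A.
  apply/seteqP; split=> y; first by right.
  by move=> [/(sub_cl sA)|].
have := rk_cl sA; rewrite -eC => eA.
have s1 : x |` A `<=` x |` cl M A.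
  by move=> y [->|/(sub_cl sA) ?]; [left|right].
have s2 : x |` cl M A `<=` ground M by move=> y [->|[]].
have s3 : A `<=` x |` A by move=> y; right.
have := rk_mono s1 s2; have := rk_mono s3 (subset_trans s1 s2); lia.
Qed.

Lemma flat_rk_lt T (M : matroid T) (F G : set T) :
  flat M F -> G `<=` ground M -> ~ G `<=` F -> rk M F < rk M (F `|` G).
Proof.
move=> fF sG nGF; rewrite ltnNge; apply/negP => le.
have s : F `|` G `<=` ground M by move=> x [/(proj1 fF)|/sG].
apply/nGF/(flat_absorb fF sG)/eqP.
by rewrite eqn_leq le (rk_mono (fun x Fx => or_introl Fx) s).
Qed.

Lemma flat_ground T (M : matroid T) : flat M (ground M).
Proof. by split. Qed.


Lemma flat_full T (M : matroid T) (F : set T) :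
  flat M F -> rank M <= rk M F -> F = ground M.
Proof.
move=> fF le; apply/seteqP; split; first exact: (proj1 fF).
apply: (flat_absorb fF) => //.
rewrite (setUidr (proj1 fF)); apply/eqP; rewrite eqn_leq le.
by rewrite (rk_mono (proj1 fF)).
Qed.

Lemma flatI T (M : matroid T) (F G : set T) :
  flat M F -> flat M G -> flat M (F `&` G).
Proof.
move=> fF fG; have [sF _] := fF; have [sG _] := fG.
split=> [x [/sF]//|x gx]; rewrite setUC => e.
have gx1 : [set x] `<=` ground M by move=> _ ->.
have eF := rk_adjoin_eq sF gx1 (@subIsetl _ F G) e.
have eG := rk_adjoin_eq sG gx1 (@subIsetr _ F G) e.
by split; [apply: (flat_absorb fF gx1 eF)|apply: (flat_absorb fG gx1 eG)].
Qed.

(** * Consequences of OTE for hyperplanes and quotients *)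

(* Otherwise [F], [G] and the ground set form a non-principal modular cut. *)
Lemma OTE_hyperplanes_modular T (M : matroid T) (F G : set T) :
  OTE M -> flat M F -> flat M G ->
  (rk M F).+1 = rank M -> (rk M G).+1 = rank M -> ~ G `<=` F ->
  modular_pair M F G.
Proof.
move=> oM fF fG rF rG nGF; apply: contrapT => nmod.
have [sF _] := fF; have [sG _] := fG.
pose C : set (set T) := [set K | K = F \/ K = G \/ K = ground M].
have up H F' : flat M H -> (rk M H).+1 = rank M -> flat M F' -> H `<=` F' ->
    F' = H \/ F' = ground M.
  move=> fH rH fF' HF'; have [le|nle] := EM (F' `<=` H).
    by left; apply/seteqP.
  right; apply: flat_full => //.
  have := flat_rk_lt fH (proj1 fF') nle.
  by rewrite (setUidr HF') rH.
have mC : modular_cut M C.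
  split.
  - by move=> K [->|[->|->]] //; exact: flat_ground.
  - move=> K F' [->|[->|->]] fF' KF'.
    + by case: (up F F' fF rF fF' KF') => ->; [left|right; right].
    + by case: (up G F' fG rG fF' KF') => ->; right; [left|right].
    + by right; right; apply/seteqP; split=> //; exact: (proj1 fF').
  - move=> F1 F2 [->|[->|->]] [->|[->|->]] //.
    + by rewrite setIid; left.
    + by rewrite (setIidl sF); left.
    + rewrite /modular_pair addnC setUC setIC => e; case: nmod; exact: e.
    + by rewrite setIid; right; left.
    + by rewrite (setIidl sG); right; left.
    + by rewrite (setIidr sF); left.
    + by rewrite (setIidr sG); right; left.
    + by rewrite setIid; right; right.
have [|K [fK eC]] := oM C mC.
  by move=> e; suff: C F; [rewrite e|left].
have KF : K `<=` F by suff: C F; [rewrite eC => -[]|left].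
have KG : K `<=` G by suff: C G; [rewrite eC => -[]|right; left].
(* The generator lies below both hyperplanes and is itself [F], [G] or the ground set; each choice
   puts [G] inside [F]. *)
have : C K by rewrite eC; split.
case=> [eK|[eK|eK]].
- apply: nGF; apply: (flat_absorb fF sG); rewrite eK in KG.
  by rewrite (setUidr KG); apply/eqP; rewrite -eqSS rF rG.
- by rewrite -eK in nGF.
- by rewrite eK in KF; apply: nGF => x /sG/KF.
Qed.

(** Submodularity for the union of [Z] and [A] against [B]. In effect, the rank that a set loses
    when [Z] is contracted is monotone in the set. *)
Lemma extension_rk_drop T (M N : matroid T) (Z A B : set T) :
  extension M N -> Z `<=` ground N -> A `<=` B -> B `<=` ground M ->
  rk N (Z `|` B) + rk M A <= rk N (Z `|` A) + rk M B.
Proof.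
move=> [sMN eMN] sZ AB sB.
rewrite -(eMN A) -?(eMN B) //; last exact: subset_trans sB.
have sBN := subset_trans sB sMN.
by apply: rk_submod_le => //; sets.
Qed.

(* When adjoining [Z] lowers the rank of [M] by exactly one, the flats whose
   rank drops form a modular cut that does not contain the flat of rank 0. *)
Lemma OTE_elementary_quotient T (M N : matroid T) (Z F G : set T) :
  OTE M -> extension M N -> Z `<=` ground N ->
  rk N (Z `|` ground M) + 1 = rk N Z + rank M ->
  flat M F -> flat M G ->
  rk N (Z `|` F) < rk N Z + rk M F -> rk N (Z `|` G) < rk N Z + rk M G ->
  0 < rk M (F `&` G).
Proof.
move=> oM ext sZ rE fF fG dF dG; have [sMN eMN] := ext.
pose C : set (set T) := [set K | flat M K /\ rk N (Z `|` K) < rk N Z + rk M K].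
have drop := extension_rk_drop ext sZ.
have mC : modular_cut M C.
  split.
  - by move=> K [].
  - move=> K K' [fK dK] fK' KK'; split=> //.
    have := drop K K' KK' (proj1 fK'); lia.
  (* [F1] and [F2] lose at least one each and their union at most one, so by modularity their
     intersection loses at least one. *)
  - move=> F1 F2 [fF1 d1] [fF2 d2] mod12; split; first exact: flatI.
    have sU : F1 `|` F2 `<=` ground M by move=> x [/(proj1 fF1)|/(proj1 fF2)].
    have := drop _ _ sU (@subset_refl _ (ground M)); rewrite -/(rank M) => dU.
    have s1 := subset_trans (proj1 fF1) sMN.
    have s2 := subset_trans (proj1 fF2) sMN.
    have := @rk_submod_le _ N (Z `|` F1) (Z `|` F2) (Z `|` (F1 `|` F2))
      (Z `|` (F1 `&` F2)) ltac:(sets) ltac:(sets) ltac:(sets) ltac:(sets).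
    move: mod12; rewrite /modular_pair; lia.
have [|K [fK eC]] := oM C mC.
  move=> e; suff: C (ground M) by rewrite e.
  by split; [exact: flat_ground|rewrite -/(rank M) -rE addn1].
have KF : K `<=` F by suff: C F; [rewrite eC => -[]|].
have KG : K `<=` G by suff: C G; [rewrite eC => -[]|].
(* The generator loses rank, so its own rank is positive, and it lies inside both [F] and [G]. *)
have [_ dK] : C K by rewrite eC; split.
have sFG : F `&` G `<=` ground M by move=> x [/(proj1 fF)].
have sK : K `<=` F `&` G by move=> x Kx; split; [exact: KF|exact: KG].
have := rk_mono sK sFG.
have sZK : Z `|` K `<=` ground N by move=> x [/sZ|/(proj1 fK)/sMN].
have := rk_mono (@subsetUl _ Z K) sZK; lia.
Qed.

(** Modularity of [X] and [Y] makes their traces skew once their intersection is contracted,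
    although in [M] the traces are not skew. So both traces lose rank, and OTE rules out a total
    loss of one. *)
Lemma OTE_modular_quotient T (M N : matroid T) (X Y : set T) :
  OTE M -> extension M N -> rank M = 4 -> flat N X -> flat N Y ->
  rk N X + rk N Y = rk N (X `|` Y) + rk N (X `&` Y) ->
  flat M (X `&` ground M) -> flat M (Y `&` ground M) ->
  rk M (X `&` Y `&` ground M) = 0 ->
  0 < rk M (X `&` ground M) -> 0 < rk M (Y `&` ground M) ->
  rk M (X `&` ground M) + rk M (Y `&` ground M)
    = (rk M ((X `|` Y) `&` ground M)).+1 ->
  [/\ rk N (X `&` Y `|` X `&` ground M) = (rk N (X `&` Y)).+1,
      rk N (X `&` Y `|` Y `&` ground M) = (rk N (X `&` Y)).+1
    & rk N (X `|` Y `|` ground M) = rk N (X `|` Y)].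
Proof.
move=> oM ext rM fX fY modXY fF fG rFG rF rG; have [sMN eMN] := ext.
have [sX _] := fX; have [sY _] := fY.
rewrite setIUl.
have eI : X `&` ground M `&` (Y `&` ground M) = X `&` Y `&` ground M by seteq.
rewrite -eI in rFG.
set F := X `&` ground M in fF rF rFG *; set G := Y `&` ground M in fG rG rFG *.
set Z := X `&` Y in modXY *.
move=> rFUG.
have sZ : Z `<=` ground N by move=> x [/sX].
have sF : F `<=` ground M by case: fF.
have sG : G `<=` ground M by case: fG.
have sFX : F `<=` X by move=> x [].
have sGY : G `<=` Y by move=> x [].
have sFN := subset_trans sF sMN; have sGN := subset_trans sG sMN.
have sZX : Z `<=` X by move=> x [].
have sZY : Z `<=` Y by move=> x [].
have fZ : flat N Z by exact: flatI.
(* With [modXY], the sum of [h1] and [h2] says that the ranks of [F] and [G] over [Z] add up to at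
   most the rank of their union over [Z]. *)
have h1 : rk N (X `|` G) + rk N (Z `|` F) <= rk N X + rk N (Z `|` (F `|` G)).
  by apply: rk_submod_le; sets.
have h2 : rk N (X `|` Y) + rk N (Z `|` G) <= rk N Y + rk N (X `|` G).
  by apply: rk_submod_le; sets.
have rk0 (K : set T) : K `<=` F `&` G -> rk M K = 0.
  move=> sK; have sFG : F `&` G `<=` ground M by move=> x [/sF].
  have := rk_mono sK sFG; lia.
(* A trace of positive rank cannot lie in the flat [Z], which meets the ground set of [M] in rank
   0. *)
have qF : rk N Z < rk N (Z `|` F).
  apply: flat_rk_lt => // sFZ; rewrite rk0 // in rF.
  by move=> x Fx; split=> //; split; [case: (sFZ x Fx)|exact: sF].
have qG : rk N Z < rk N (Z `|` G).
  apply: flat_rk_lt => // sGZ; rewrite rk0 // in rG.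
  by move=> x Gx; split=> //; split; [case: (sGZ x Gx)|exact: sG].
have drop := extension_rk_drop ext sZ.
have sFG : F `|` G `<=` ground M by move=> x [/sF|/sG].
have dF := drop _ _ (@subsetUl _ F G) sFG.
have dG := drop _ _ (@subsetUr _ F G) sFG.
have dFG := drop _ _ sFG (@subset_refl _ (ground M)).
have dE := drop _ _ (@sub0set _ (ground M)) (@subset_refl _ (ground M)).
have dF0 := drop _ _ (@sub0set _ F) sF.
have dG0 := drop _ _ (@sub0set _ G) sG.
have eZFG : Z `|` (F `|` G) `|` ground M = Z `|` ground M.
  by seteq.
have mE : rk N (Z `|` (F `|` G)) <= rk N (Z `|` ground M).
  by apply: rk_mono; sets.
have el := @OTE_elementary_quotient _ _ _ Z F G oM ext sZ.
rewrite setU0 rk_set0 in dE dF0 dG0; rewrite /rank in rM el.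
(* Skewness and monotone loss force both [F] and [G] to lose rank, so a total loss of one would
   contradict [rFG]. *)
have nq3 : rk N (Z `|` ground M) <> rk N Z + 3.
  move=> e; have := el ltac:(lia) fF fG ltac:(lia) ltac:(lia); lia.
split; [lia|lia|].
(* The quotient now has rank 2, and [F] and [G], of rank 1 each, already span it. *)
have e : rk N (Z `|` (F `|` G) `|` ground M) = rk N (Z `|` (F `|` G)).
  by rewrite eZFG; lia.
apply: (rk_adjoin_eq _ _ _ e) => //.
  by move=> x [/sX|/sY].
by sets.
Qed.

(** * The function [eta], flat hulls and repaired submodularity *)

Definition compatible T (M N1 N2 : matroid T) : Prop :=
  [/\ extension M N1, extension M N2 & ground N1 `&` ground N2 = ground M].

Lemma compatibleC T (M N1 N2 : matroid T) :
  compatible M N1 N2 -> compatible M N2 N1.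
Proof. by case=> e1 e2 eI; split; rewrite // setIC. Qed.

(* The subtraction is never truncated, see [eta_add]. *)
Definition eta T (M N1 N2 : matroid T) (X : set T) : nat :=
  rk N1 (X `&` ground N1) + rk N2 (X `&` ground N2) - rk M (X `&` ground M).

Lemma etaC T (M N1 N2 : matroid T) : eta M N1 N2 = eta M N2 N1.
Proof. by apply: funext => X; rewrite /eta addnC. Qed.

Lemma extension_rk_le T (M N : matroid T) (X : set T) :
  extension M N -> rk M (X `&` ground M) <= rk N (X `&` ground N).
Proof.
move=> [sMN eMN]; rewrite -eMN; last by move=> x [].
by apply: rk_mono; sets.
Qed.

Lemma eta_add T (M N1 N2 : matroid T) (X : set T) : extension M N1 ->
  eta M N1 N2 X + rk M (X `&` ground M)
    = rk N1 (X `&` ground N1) + rk N2 (X `&` ground N2).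
Proof.
move=> ext; rewrite /eta subnK //.
by rewrite (leq_trans (extension_rk_le X ext)) // leq_addr.
Qed.

(** The term in [N1] is unchanged. Since [S] meets [ground N2] only inside [ground M], submodularity
    in [N2] bounds the gain there by the gain of the subtracted term. *)
Lemma eta_adjoin T (M N1 N2 : matroid T) (X S : set T) :
  compatible M N1 N2 -> S `<=` ground N1 ->
  rk N1 (X `&` ground N1 `|` S) = rk N1 (X `&` ground N1) ->
  eta M N1 N2 (X `|` S) <= eta M N1 N2 X.
Proof.
move=> [ext1 ext2 eI] sS eS.
have := eta_add N2 X ext1; have := eta_add N2 (X `|` S) ext1.
have -> : (X `|` S) `&` ground N1 = X `&` ground N1 `|` S by seteq.
rewrite {}eS.
have [s1 e1] := ext1; have [s2 e2] := ext2.
have sI : ground M `<=` ground N1 `&` ground N2 by rewrite eI.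
have sI' : ground N1 `&` ground N2 `<=` ground M by rewrite eI.
have := e2 (X `&` ground M) ltac:(sets).
have := e2 ((X `|` S) `&` ground M) ltac:(sets).
have := @rk_submod_le _ N2 (X `&` ground N2) ((X `|` S) `&` ground M)
  ((X `|` S) `&` ground N2) (X `&` ground M) ltac:(sets) ltac:(sets)
  ltac:(sets) ltac:(sets).
lia.
Qed.

Lemma flat_trace T (M N : matroid T) (X : set T) :
  extension M N -> flat N (X `&` ground N) -> flat M (X `&` ground M).
Proof.
move=> [sMN eMN] fX; split=> [x []//|x gx].
have gx1 : [set x] `<=` ground N by move=> _ ->; apply: sMN.
rewrite -(eMN (x |` _)); last by move=> y [->|[]].
rewrite -(eMN (X `&` _)); last by move=> y [].
rewrite setUC => e; split=> //.
have sX : X `&` ground N `<=` ground N by move=> y [].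
have sXX : X `&` ground M `<=` X `&` ground N by sets.
by have [] := flat_absorb fX gx1 (rk_adjoin_eq sX gx1 sXX e) (erefl x).
Qed.

(** Closing the trace in one extension may enlarge the trace in the other, so closing is repeated.
    Each repetition raises the rank of the trace on [M], which is bounded. *)
Lemma eta_flat_hull T (M N1 N2 : matroid T) (X : set T) :
  compatible M N1 N2 ->
  exists2 Y : set T, X `<=` Y &
    [/\ eta M N1 N2 Y <= eta M N1 N2 X, flat N1 (Y `&` ground N1)
      & flat N2 (Y `&` ground N2)].
Proof.
move=> cN; have [ext1 ext2 eI] := cN.
have [k] := ubnP (rank M - rk M (X `&` ground M)).
elim: k X => // k IH X; rewrite ltnS => lek.
have [s1 e1] := ext1; have [s2 e2] := ext2.
have sI : ground N1 `&` ground N2 `<=` ground M by rewrite eI.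
pose A1 := cl N1 (X `&` ground N1); pose A2 := cl N2 (X `&` ground N2).
have sX1 : X `&` ground N1 `<=` ground N1 by sets.
have sX2 : X `&` ground N2 `<=` ground N2 by sets.
have sA1 : A1 `<=` ground N1 by move=> x [].
have sA2 : A2 `<=` ground N2 by move=> x [].
pose Y := X `|` A1 `|` A2.
have XY : X `<=` Y by rewrite /Y; sets.
have eY : eta M N1 N2 Y <= eta M N1 N2 X.
  apply: (@leq_trans (eta M N1 N2 (X `|` A1))); last first.
    by apply: eta_adjoin => //; exact: rk_cl.
  rewrite etaC; apply: eta_adjoin => //; first exact: compatibleC.
  apply: (@rk_adjoin_eq _ _ (X `&` ground N2)); rewrite ?rk_cl //; by sets.
have sY0 : Y `&` ground M `<=` ground M by sets.
have sXY0 : X `&` ground M `<=` Y `&` ground M by sets.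
have leY0 := rk_mono sY0 (@subset_refl _ _).
have leXY0 := rk_mono sXY0 sY0.
have [lt|ge] := ltnP (rk M (X `&` ground M)) (rk M (Y `&` ground M)).
  have [|Y' YY' [eY' f1 f2]] := IH Y; first by move: leY0; rewrite /rank in lek *; lia.
  exists Y'; first exact: subset_trans YY'.
  by split=> //; exact: leq_trans eY.
(* The rank of the trace on [M] has stabilised, so new elements of [ground M] are already in both
   closures. *)
have cl0 N x : extension M N -> Y x -> ground M x ->
    cl N (X `&` ground N) x.
  move=> [sMN eMN] Yx Mx; split; first exact: sMN.
  rewrite setUC; apply: (@rk_adjoin_eq _ _ (X `&` ground M)); rewrite ?eMN //.
  - by move=> _ ->; apply: sMN.
  - by sets.
  - apply/eqP; rewrite eqn_leq; apply/andP; split.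
      apply: (leq_trans _ ge); apply: rk_mono => // y [/sXY0|->] //; split.
    by apply: rk_mono => // y [[]|->].
  - by move=> y [[]|->].
have cX1 := sub_cl sX1; have cX2 := sub_cl sX2.
exists Y => //; split=> //.
- have -> : Y `&` ground N1 = A1; last exact: flat_cl.
  apply/seteqP; split; last by rewrite /Y; sets.
  move=> x [Yx x1]; case: (Yx) => [[Xx|//]|x2]; first exact: cX1.
  by apply: cl0 => //; apply: sI; split=> //; exact: sA2.
- have -> : Y `&` ground N2 = A2; last exact: flat_cl.
  apply/seteqP; split; last by rewrite /Y; sets.
  move=> x [Yx x2]; case: (Yx) => [[Xx|x1]|//]; first exact: cX2.
  by apply: cl0 => //; apply: sI; split=> //; exact: sA1.
Qed.

(* Submodularity of [eta] can fail on [X] and [Y] themselves, but then one of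
   [X `&` Y] and [X `|` Y] has a superset on which [eta] is smaller. *)
Lemma eta_submod T (M N1 N2 : matroid T) (X Y : set T) :
  OTE M -> rank M = 4 -> compatible M N1 N2 ->
  flat N1 (X `&` ground N1) -> flat N2 (X `&` ground N2) ->
  flat N1 (Y `&` ground N1) -> flat N2 (Y `&` ground N2) ->
  exists U V : set T, [/\ X `&` Y `<=` U, X `|` Y `<=` V
    & eta M N1 N2 U + eta M N1 N2 V <= eta M N1 N2 X + eta M N1 N2 Y].
Proof.
move=> oM rM cN fX1 fX2 fY1 fY2; have [ext1 ext2 eI] := cN.
have [le|gt] := leqP (eta M N1 N2 (X `&` Y) + eta M N1 N2 (X `|` Y))
                     (eta M N1 N2 X + eta M N1 N2 Y).
  by exists (X `&` Y), (X `|` Y); split.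
have fX := flat_trace ext1 fX1; have fY := flat_trace ext1 fY1.
have [s1 e1] := ext1; have [s2 e2] := ext2.
have eta_def K := eta_add N2 K ext1.
have dX := eta_def X; have dY := eta_def Y.
have dI := eta_def (X `&` Y); have dU := eta_def (X `|` Y).
have rw_cap (G : set T) : X `&` Y `&` G = (X `&` G) `&` (Y `&` G) by seteq.
have rw_cup (G : set T) : (X `|` Y) `&` G = X `&` G `|` Y `&` G by seteq.
rewrite !rw_cap in dI; rewrite !rw_cup in dU.
have sm1 := rk_submod (proj1 fX1) (proj1 fY1).
have sm2 := rk_submod (proj1 fX2) (proj1 fY2).
set F := X `&` ground M in fX dX dI dU *.
set G := Y `&` ground M in fY dY dI dU *.
have [sF _] := fX; have [sG _] := fY.
have sFG : F `|` G `<=` ground M by sets.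
(* Nested traces have no defect in [M], so submodularity in [N1] and [N2] would suffice. *)
have nFG : ~ F `<=` G.
  by move=> FG; rewrite (setIidl FG) (setUidr FG) in dI dU; lia.
have nGF : ~ G `<=` F.
  by move=> GF; rewrite (setIidr GF) (setUidl GF) in dI dU; lia.
have ltF := flat_rk_lt fX sG nGF.
have ltG := flat_rk_lt fY sF nFG; rewrite setUC in ltG.
have fFG := flatI fX fY.
have ltmF : rk M (F `&` G) < rk M F.
  rewrite -[X in _ < rk M X](@setUidr _ (F `&` G)); last by sets.
  by apply: flat_rk_lt => // H; apply: nFG => x /H [].
have ltmG : rk M (F `&` G) < rk M G.
  rewrite -[X in _ < rk M X](@setUidr _ (F `&` G)); last by sets.
  by apply: flat_rk_lt => // H; apply: nGF => x /H [].
have le4 := rk_mono sFG (@subset_refl _ _); rewrite -/(rank M) rM in le4.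
have n33 : ~ (rk M F = 3 /\ rk M G = 3).
  move=> [rF rG]; have : modular_pair M F G.
    by apply: OTE_hyperplanes_modular => //; rewrite rM ?rF ?rG.
  by rewrite /modular_pair; lia.
(* The ranks of [F] and [G] are now 2 and 2 with union of rank 3, or 2 and 3 with union of rank 4.
   The defect in [M] is 1, the traces meet in rank 0, and the defects in [N1] and [N2] vanish. *)
have quotient N : extension M N -> flat N (X `&` ground N) ->
    flat N (Y `&` ground N) ->
    rk N (X `&` ground N) + rk N (Y `&` ground N) =
    rk N (X `&` ground N `|` Y `&` ground N)
      + rk N (X `&` ground N `&` (Y `&` ground N)) ->
    [/\ rk N ((X `&` Y `|` F) `&` ground N) = (rk N (X `&` Y `&` ground N)).+1,
        rk N ((X `&` Y `|` G) `&` ground N) = (rk N (X `&` Y `&` ground N)).+1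
      & rk N ((X `|` Y `|` ground M) `&` ground N)
          = rk N ((X `|` Y) `&` ground N)].
  move=> ext fXN fYN mod; have [sMN eMN] := ext.
  have trX : X `&` ground N `&` ground M = F by rewrite /F; seteq.
  have trY : Y `&` ground N `&` ground M = G by rewrite /G; seteq.
  have := OTE_modular_quotient oM ext rM fXN fYN mod.
  have -> : X `&` ground N `&` (Y `&` ground N) `&` ground M = F `&` G.
    by rewrite /F /G; seteq.
  rewrite setIUl trX trY => /(_ fX fY ltac:(lia) ltac:(lia) ltac:(lia) ltac:(lia)).
  have sFM : F `<=` X `&` ground M by [].
  have sGM : G `<=` Y `&` ground M by [].
  have -> : X `&` ground N `&` (Y `&` ground N) = X `&` Y `&` ground N by seteq.
  have -> : X `&` ground N `|` Y `&` ground N = (X `|` Y) `&` ground N by seteq.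
  have -> : (X `&` Y `|` F) `&` ground N = X `&` Y `&` ground N `|` F by seteq.
  have -> : (X `&` Y `|` G) `&` ground N = X `&` Y `&` ground N `|` G by seteq.
  have -> : (X `|` Y `|` ground M) `&` ground N
      = (X `|` Y) `&` ground N `|` ground M by seteq.
  by [].
have [q1F q1G q1E] := quotient N1 ext1 fX1 fY1 ltac:(lia).
have [q2F q2G q2E] := quotient N2 ext2 fX2 fY2 ltac:(lia).
rewrite !rw_cap in q1F q1G q2F q2G; rewrite !rw_cup in q1E q2E.
have dF := eta_def (X `&` Y `|` F); have dG := eta_def (X `&` Y `|` G).
have dE := eta_def (X `|` Y `|` ground M).
have tF : (X `&` Y `|` F) `&` ground M = F by rewrite /F; seteq.
have tG : (X `&` Y `|` G) `&` ground M = G by rewrite /G; seteq.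
have tE : (X `|` Y `|` ground M) `&` ground M = ground M by seteq.
rewrite tF in dF; rewrite tG in dG; rewrite tE -/(rank M) in dE.
(* Adjoining a plane to the intersection adds one in each extension but three to the subtracted
   rank. *)
have [rG|nG] := eqVneq (rk M G) 3.
  exists (X `&` Y `|` G), (X `|` Y); split=> //; lia.
have [rF|nF] := eqVneq (rk M F) 3.
  exists (X `&` Y `|` F), (X `|` Y); split=> //; lia.
(* For two coplanar lines, adjoining [ground M] to the union only raises the subtracted rank, from 3
   to 4. *)
exists (X `&` Y), (X `|` Y `|` ground M); split=> //; lia.
Qed.

(** * The rank function [zeta] of the proper amalgam *)

Lemma min_superset_subproof T (f : set T -> nat) (A : set T) :
  exists n, `[< exists2 X, A `<=` X & f X = n >].
Proof. by exists (f A); apply/asboolP; exists A. Qed.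

Definition min_superset T (f : set T -> nat) (A : set T) : nat :=
  ex_minn (min_superset_subproof f A).

Lemma min_superset_le T (f : set T -> nat) (A X : set T) :
  A `<=` X -> min_superset f A <= f X.
Proof.
move=> AX; rewrite /min_superset; case: ex_minnP => n _; apply.
by apply/asboolP; exists X.
Qed.

Lemma min_supersetP T (f : set T -> nat) (A : set T) :
  exists2 X, A `<=` X & f X = min_superset f A.
Proof. by rewrite /min_superset; case: ex_minnP => n /asboolP. Qed.

Definition zeta T (M N1 N2 : matroid T) : set T -> nat :=
  min_superset (eta M N1 N2).

Lemma zetaC T (M N1 N2 : matroid T) : zeta M N1 N2 = zeta M N2 N1.
Proof. by rewrite /zeta etaC. Qed.

Lemma zeta_mono T (M N1 N2 : matroid T) (A B : set T) :
  A `<=` B -> zeta M N1 N2 A <= zeta M N1 N2 B.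
Proof.
rewrite /zeta => AB; have [X BX <-] := min_supersetP (eta M N1 N2) B.
exact/min_superset_le/(subset_trans AB).
Qed.

Lemma zeta_submod T (M N1 N2 : matroid T) (A B : set T) :
  OTE M -> rank M = 4 -> compatible M N1 N2 ->
  zeta M N1 N2 (A `|` B) + zeta M N1 N2 (A `&` B)
    <= zeta M N1 N2 A + zeta M N1 N2 B.
Proof.
rewrite /zeta => oM rM cN.
have [X0 AX0 <-] := min_supersetP (eta M N1 N2) A.
have [Y0 BY0 <-] := min_supersetP (eta M N1 N2) B.
have [X X0X [eX fX1 fX2]] := eta_flat_hull X0 cN.
have [Y Y0Y [eY fY1 fY2]] := eta_flat_hull Y0 cN.
have [U [V [sU sV]]] := eta_submod oM rM cN fX1 fX2 fY1 fY2.
have := @min_superset_le _ (eta M N1 N2) (A `&` B) U ltac:(sets).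
have := @min_superset_le _ (eta M N1 N2) (A `|` B) V ltac:(sets).
lia.
Qed.

(** [X] itself attains this value, its traces on [N2] and [M] being equal. No superset does better,
    as the rank in [N2] of its trace is at least the subtracted term. *)
Lemma zeta_left T (M N1 N2 : matroid T) (X : set T) :
  compatible M N1 N2 -> X `<=` ground N1 -> zeta M N1 N2 X = rk N1 X.
Proof.
rewrite /zeta => -[ext1 ext2 eI] sX; apply/eqP; rewrite eqn_leq; apply/andP; split.
  have := @min_superset_le _ (eta M N1 N2) X X (@subset_refl _ X).
  have := eta_add N2 X ext1; rewrite (setIidl sX).
  have -> : X `&` ground N2 = X `&` ground M by rewrite -eI setIA (setIidl sX).
  rewrite (proj2 ext2); last by sets.
  lia.
have [Y XY <-] := min_supersetP (eta M N1 N2) X.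
have sXY : X `<=` Y `&` ground N1 by sets.
have sY : Y `&` ground N1 `<=` ground N1 by sets.
have := rk_mono sXY sY.
have := eta_add N2 Y ext1; have := extension_rk_le Y ext2; lia.
Qed.

Lemma zeta_right T (M N1 N2 : matroid T) (X : set T) :
  compatible M N1 N2 -> X `<=` ground N2 -> zeta M N1 N2 X = rk N2 X.
Proof. by move=> cN; rewrite zetaC; apply/zeta_left/compatibleC. Qed.

(** [zeta_submod] reduces the bound to single elements, each lying in [ground N1] or [ground N2],
    where [zeta] is a matroid rank. *)
Lemma zeta_card T (M N1 N2 : matroid T) (X : set T) (n : nat) :
  OTE M -> rank M = 4 -> compatible M N1 N2 ->
  X `<=` ground N1 `|` ground N2 -> X #= `I_n -> zeta M N1 N2 X <= n.
Proof.
move=> oM rM cN; elim: n X => [|n IH] X sX.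
  rewrite II0 card_eq0 => /eqP ->.
  by rewrite (zeta_left cN) // rk_set0.
move=> /eq_cardSP[x Xx cX].
have le1 : zeta M N1 N2 [set x] <= 1.
  have c1 : [set x] #= `I_1.
    apply/eq_cardSP; exists x => //.
    by rewrite II0 card_eq0 setDv.
  case: (sX x Xx) => gx.
    have sx : [set x] `<=` ground N1 by move=> _ ->.
    by rewrite (zeta_left cN) // rk_card.
  have sx : [set x] `<=` ground N2 by move=> _ ->.
  by rewrite (zeta_right cN) // rk_card.
have := IH _ (fun y (h : (X `\ x) y) => sX y h.1) cX.
have := zeta_submod (X `\ x) [set x] oM rM cN.
have -> : X `\ x `|` [set x] = X.
  apply/seteqP; split=> y; first by case=> [[]|->].
  by move=> Xy; have [->|ne] := EM (y = x); [right|left].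
lia.
Qed.

(** Finite sets of full rank in the two traces suffice: any superset of them spans both traces,
    which can be adjoined without raising [eta]. *)
Lemma zeta_finitary T (M N1 N2 : matroid T) (X : set T) :
  compatible M N1 N2 -> X `<=` ground N1 `|` ground N2 ->
  exists I : set T,
    [/\ I `<=` X, finite_set I & zeta M N1 N2 I = zeta M N1 N2 X].
Proof.
move=> cN sX; have [ext1 ext2 eI] := cN.
have sX1 : X `&` ground N1 `<=` ground N1 by sets.
have sX2 : X `&` ground N2 `<=` ground N2 by sets.
have [I1 [sI1 finI1 eI1]] := rk_finitary sX1.
have [I2 [sI2 finI2 eI2]] := rk_finitary sX2.
have sI : I1 `|` I2 `<=` X by sets.
exists (I1 `|` I2); split=> //; first by rewrite finite_setU.
apply/eqP; rewrite eqn_leq zeta_mono //= /zeta.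
have [Y IY <-] := min_supersetP (eta M N1 N2) (I1 `|` I2).
have spanned N I W : I `<=` X `&` ground N -> rk N I = rk N (X `&` ground N) ->
    I `<=` W ->
    rk N (W `&` ground N `|` X `&` ground N) = rk N (W `&` ground N).
  move=> sIX e IW; apply: (@rk_adjoin_eq _ _ I); rewrite ?(setUidr sIX) //; sets.
apply: (@leq_trans (eta M N1 N2 (Y `|` X `&` ground N1 `|` X `&` ground N2))).
  by apply: min_superset_le; sets.
apply: (@leq_trans (eta M N1 N2 (Y `|` X `&` ground N1))).
  rewrite etaC; apply: eta_adjoin => //; first exact: compatibleC.
  by apply: (@spanned _ I2) => //; sets.
by apply: eta_adjoin => //; apply: (@spanned _ I1) => //; sets.
Qed.

(** * Stickiness and passage to isomorphic copies *)

Lemma OTE_rank4_sticky_within U (M : matroid U) :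
  OTE M -> rank M = 4 -> sticky_within M.
Proof.
move=> oM rM N1 N2 ext1 ext2 eI.
have cN : compatible M N1 N2 by [].
pose N := @Matroid _ (ground N1 `|` ground N2) (zeta M N1 N2)
  (fun X n => @zeta_card _ M N1 N2 X n oM rM cN)
  (fun X Y XY _ => zeta_mono M N1 N2 XY)
  (fun X Y _ _ => zeta_submod X Y oM rM cN)
  (fun X => @zeta_finitary _ M N1 N2 X cN).
exists N; split=> //; split=> /=.
- by move=> x; left.
- by move=> X sX; exact: zeta_left.
- by move=> x; right.
- by move=> X sX; exact: zeta_right.
Qed.

(** The modular cut is pulled back along [f], and the generator found in [M] is pushed forward. *)
Lemma OTE_isomorphic T U (M : matroid T) (M' : matroid U) :
  isomorphic M M' -> OTE M -> OTE M'.
Proof.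
move=> [f [injf gM' rkf]] oM C' [flC' upC' modC'] nC'.
have inj x y : ground M x -> ground M y -> f x = f y -> x = y.
  by move=> gx gy; apply: injf; rewrite inE.
(* [f] is injective on [ground M] only, so preimages are cut down to it. *)
have imK A : A `<=` ground M -> ground M `&` f @^-1` (f @` A) = A.
  move=> sA; apply/seteqP; split=> x; last by move=> Ax; split; [exact: sA|exists x].
  by move=> [gx [y Ay /inj<-//]]; exact: sA.
have preK B : B `<=` ground M' -> f @` (ground M `&` f @^-1` B) = B.
  move=> sB; apply/seteqP; split=> [_ [x [_ ?] <-]//|y By].
  by have := sB y By; rewrite gM' => -[x gx e]; exists x => //; split=> //=; rewrite e.
have flat_im A : flat M A -> flat M' (f @` A).
  move=> [sA flA]; split=> [|y]; first by rewrite gM'; exact: image_subset.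
  rewrite gM' => -[x gx <-]; rewrite -image_set1 -image_setU !rkf //.
    by move=> /(flA x gx) Ax; exists x.
  by move=> z [->|/sA].
have flat_pre A : A `<=` ground M -> flat M' (f @` A) -> flat M A.
  move=> sA [_ flA]; split=> // x gx e.
  have : (f @` A) (f x).
    apply: flA; first by rewrite gM'; exists x.
    rewrite -image_set1 -image_setU !rkf // => z [->|/sA] //.
  by move=> [y Ay /inj <-] //; exact: sA.
have imI A B : A `<=` ground M -> B `<=` ground M ->
    f @` (A `&` B) = f @` A `&` f @` B.
  move=> sA sB; apply/seteqP; split; first exact: sub_image_setI.
  move=> _ [[x Ax <-] [y By /inj e]]; exists x => //; split=> //.
  by rewrite -e //; [exact: sB|exact: sA].
pose C : set (set T) := [set A | A `<=` ground M /\ C' (f @` A)].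
have mC : modular_cut M C.
  split.
  - by move=> A [sA /flC']; exact: flat_pre.
  - move=> A B [sA CA] fB AB; split; first by case: fB.
    by apply: upC' CA (flat_im _ fB) _; exact: image_subset.
  - move=> A B [sA CA] [sB CB] mod; split; first by move=> x [/sA].
    rewrite imI //; apply: modC' => //.
    rewrite /modular_pair -imI // -image_setU !rkf //.
      by move=> x [/sA].
    by move=> x [/sA|/sB].
have [|F [fF eC]] := oM C mC.
  move=> e; apply: nC'; apply/seteqP; split=> // B CB.
  suff: C (ground M `&` f @^-1` B) by rewrite e.
  by split=> [x []//|]; rewrite preK //; exact: (proj1 (flC' B CB)).
exists (f @` F); split; first exact: flat_im.
apply/seteqP; split=> B.
  move=> CB; have sB := proj1 (flC' B CB); split; first exact: flC'.
  have : C (ground M `&` f @^-1` B) by split=> [x []//|]; rewrite preK.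
  by rewrite eC => -[_ FB] _ [x /FB[_ ?] <-].
move=> [fB FB]; have sB := proj1 fB.
suff: C (ground M `&` f @^-1` B) by move=> [_]; rewrite preK.
rewrite eC; split; first by apply: flat_pre => [x []//|]; rewrite preK.
by move=> x Fx; split; [exact: (proj1 fF)|apply: FB; exists x].
Qed.

Theorem theorem5 (T : Type) (M : matroid T) :
  rank M = 4 -> OTE M -> sticky M.
Proof.
move=> rM oM U M' iso; apply: OTE_rank4_sticky_within.
  exact: OTE_isomorphic iso oM.
by have [f [_ gM' rkf]] := iso; rewrite /rank gM' rkf.
Qed.
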